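(* Let $\Omega$, $\mathbb{K}$, $g$ be as in the context, and let $\mathfrak{A},\mathfrak{B}$ be nonempty families of subsets of $\mathbb{K}$, each satisfying $(p)$, $(\diamond)$, $(\omega)$, and jointly satisfying $(s)$. Let $(\varsigma_\mu)_{\mu>0}$ be a regular family of probability densities such that $$\lim_{\mu\downarrow 0}\int_0^T\varsigma_\mu(t)\,dt=0\qquad\text{for all }T>0.$$ For the family of probability densities $\varpi_\lambda=\lambda 1_{[0,1/\lambda]}$ $(\lambda>0)$ assume that 1. for all sufficiently small $r\in(0,1)$, the game family with payoffs $\mathbbm{c}^{|r\rangle}[\varpi_\lambda]$ $(\lambda>0)$ has an asymptotic saddle point; 2. the game family with probability densities $\varpi_\lambda$ $(\lambda>0)$ has an asymptotic saddle point, and there exists a function $V_*:\Omega\to\mathbb{R}$ which is the common limit, as $\lambda\downarrow0$, of $\mathcal{V}^{\flat}[\varpi_\lambda]$ and of $\mathcal{V}^{\sharp}[\varpi_\lambda]$, uniformly in $\omega\in\Omega$. Then the game family with probability densities $\varsigma_\mu$ $(\mu>0)$ has an asymptotic saddle point, and the common limit of $\mathcal{V}^{\flat}[\varsigma_\mu]$ and $\mathcal{V}^{\sharp}[\varsigma_\mu]$ as $\mu\downarrow0$ exists, is uniform in $\omega\in\Omega$, and coincides with $V_*$.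
   Context: **Dynamics.** $\Omega$ is a set (of states); $\mathbb{K}$ is a set of mappings $\mathbb{R}_{\ge0}\to\Omega$ (feasible processes); $g:\Omega\to[0,1]$ is a running cost such that $t\mapsto g(z(t))$ is Borel-measurable for every $z\in\mathbb{K}$. For $\omega\in\Omega$, $\Gamma(\omega)=\{z\in\mathbb{K}: z(0)=\omega\}$. For $\tau\ge0$ and $z',z''\in\mathbb{K}$ with $z'(\tau)=z''(0)$, the concatenation $z'\diamond_\tau z''$ is the map equal to $z'(t)$ for $t<\tau$ and to $z''(t-\tau)$ for $t\ge\tau$. A set $A\subset\mathbb{K}$ is a playable strategy if $A\cap\Gamma(\omega)\ne\varnothing$ for every $\omega\in\Omega$. For playable strategies $A',A''$, $A'\diamond_\tau A''=\{z'\diamond_\tau z'': z'\in A',\ z''\in A'',\ z'(\tau)=z''(0)\}$. **Axioms** for a family $\mathfrak{A}$ of subsets of $\mathbb{K}$ (and likewise for $\mathfrak{B}$): $(p)$ every element of $\mathfrak{A}$ is a playable strategy; $(\omega)$ for each mapping $\xi:\Omega\to\mathfrak{A}$ there is $A\in\mathfrak{A}$ with $\xi(\omega)\cap\Gamma(\omega)=A\cap\Gamma(\omega)$ for all $\omega\in\Omega$; $(\diamond)$ $A'\diamond_\tau A''\in\mathfrak{A}$ for all $\tau>0$ and $A',A''\in\mathfrak{A}$. Joint axiom: $(s)$ $A\cap B\cap\Gamma(\omega)\neq\varnothing$ for all $A\in\mathfrak{A}$, $B\in\mathfrak{B}$, $\omega\in\Omega$. **Values.** For bounded $c:\mathbb{K}\to\mathbb{R}$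 and $\omega\in\Omega$, $$\mathbb{V}^{\flat}[c](\omega)=\sup_{A\in\mathfrak{A}}\inf_{z\in A\cap\Gamma(\omega)}c(z),\qquad \mathbb{V}^{\sharp}[c](\omega)=\inf_{B\in\mathfrak{B}}\sup_{z\in B\cap\Gamma(\omega)}c(z).$$ A game family with bounded payoffs $c_\lambda:\mathbb{K}\to\mathbb{R}$ $(\lambda>0)$ has an asymptotic saddle point if $|\mathbb{V}^{\flat}[c_\lambda](\omega)-\mathbb{V}^{\sharp}[c_\lambda](\omega)|\to0$ as $\lambda\downarrow0$, uniformly in $\omega\in\Omega$. **Densities.** For a summable Borel-measurable $\varrho:\mathbb{R}_{\ge0}\to\mathbb{R}_{\ge0}$ put $\mathbbm{c}[\varrho](z)=\int_0^\infty\varrho(t)g(z(t))\,dt$ $(z\in\mathbb{K})$, $\mathcal{V}^{\flat}[\varrho]=\mathbb{V}^{\flat}[\mathbbm{c}[\varrho]]$, $\mathcal{V}^{\sharp}[\varrho]=\mathbb{V}^{\sharp}[\mathbbm{c}[\varrho]]$. A probability density is a Borel-measurable $\varrho:\mathbb{R}_{\ge0}\to\mathbb{R}_{\ge0}$ with $\lim_{T\to\infty}\int_0^T\varrho(t)\,dt=1$. For $r\in(0,1)$ the quantile $q[\varrho](r)$ is the minimal number with $\int_0^{q[\varrho](r)}\varrho(t)\,dt=r$. The game family with densities $\varrho_\lambda$ is the game family with payoffs $\mathbbm{c}[\varrho_\lambda]$. For a density $\varrho$ and $r\in(0,1)$: $\varrho^{|r\rangle}(t)=\varrho(t+q[\varrho](r))$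 for $t\ge0$, and for $z\in\mathbb{K}$ $$\mathbbm{c}^{|r\rangle}[\varrho](z)=\int_0^{q[\varrho](r)}\varrho(t)g(z(t))\,dt+\mathcal{V}^{\sharp}\big[\varrho^{|r\rangle}\big]\big(z(q[\varrho](r))\big).$$ $\mathrm{Var}_a^b[f]$ is the total variation of $f$ on $[a,b)$ (with $\ln 0=-\infty$; if $\ln\varrho$ takes the value $-\infty$ on the interval, the variation is $+\infty$). A family of densities $(\varrho_\lambda)_{\lambda>0}$ is regular if $\limsup_{\lambda\downarrow0}\mathrm{Var}_0^{q[\varrho_\lambda](r)}[\ln\varrho_\lambda]$ is finite for each $r\in(0,1)$. *)

(* Defs.v *)
From mathcomp Require Import all_boot all_order all_algebra.
From mathcomp Require Import all_classical all_reals all_analysis.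
Set Implicit Arguments.
Unset Strict Implicit.
Unset Printing Implicit Defensive.
Import Order.TTheory GRing.Theory Num.Theory.
Import numFieldTopology.Exports numFieldNormedType.Exports.
Local Open Scope classical_set_scope.
Local Open Scope ring_scope.

Section Dynamics.
Context {R : realType} {Omega : Type}.

Definition process := {nonneg R} -> Omega.

(* Only ever used at reals t >= 0, where the absolute value is a no-op. *)
Definition time (t : R) : {nonneg R} := `|t|%:nng.

Definition issued (K : set process) (w : Omega) : set process :=
  [set z | K z /\ z (time 0) = w].

Definition concat (tau : {nonneg R}) (z1 z2 : process) : process :=
  fun t => if t%:num < tau%:num then z1 t else z2 (time (t%:num - tau%:num)).

Definition set_concat (tau : {nonneg R}) (A1 A2 : set process) : set process :=
  [set z | exists z1 z2, [/\ A1 z1, A2 z2, z1 tau = z2 (time 0) &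
                             z = concat tau z1 z2]].

Definition playable (K A : set process) : Prop :=
  A `<=` K /\ forall w, A `&` issued K w !=set0.

Definition axiom_p (K : set process) (AA : set (set process)) : Prop :=
  forall A, AA A -> playable K A.

Definition axiom_omega (K : set process) (AA : set (set process)) : Prop :=
  forall xi : Omega -> set process, (forall w, AA (xi w)) ->
    exists2 A, AA A & forall w, xi w `&` issued K w = A `&` issued K w.

Definition axiom_concat (AA : set (set process)) : Prop :=
  forall (tau : {nonneg R}) A1 A2, 0 < tau%:num -> AA A1 -> AA A2 ->
    AA (set_concat tau A1 A2).

Definition axiom_s (K : set process) (AA BB : set (set process)) : Prop :=
  forall A B w, AA A -> BB B -> A `&` B `&` issued K w !=set0.

(* For bounded c, nonempty families and axiom (p), all the sets below are
   nonempty and bounded, so the real-valued sup and inf are the genuine ones. *)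
Definition lower_value (K : set process) (AA : set (set process))
    (c : process -> R) (w : Omega) : R :=
  sup [set inf [set c z | z in A `&` issued K w] | A in AA].

Definition upper_value (K : set process) (BB : set (set process))
    (c : process -> R) (w : Omega) : R :=
  inf [set sup [set c z | z in B `&` issued K w] | B in BB].

Definition uniform_limit0 (f : R -> Omega -> R) (l : Omega -> R) : Prop :=
  forall e : R, 0 < e -> \forall h \near 0^'+, forall w, `|f h w - l w| < e.

Definition asymptotic_saddle_point (K : set process)
    (AA BB : set (set process)) (c : R -> process -> R) : Prop :=
  uniform_limit0
    (fun h w => `|lower_value K AA (c h) w - upper_value K BB (c h) w|)
    (fun=> 0).

End Dynamics.
Arguments process R Omega : clear implicits.

Section Densities.
Context {R : realType}.
Local Notation mu := (@lebesgue_measure R).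

Definition mass (rho : R -> R) (T : R) : \bar R :=
  (\int[mu]_(t in `[0%R, T]) (rho t)%:E)%E.

(* Densities are functions on the whole line of which only the restriction to
   the half-line t >= 0 is ever used. *)
Definition is_density (rho : R -> R) : Prop :=
  [/\ measurable_fun (`[0, +oo[ : set R) rho,
      forall t, 0 <= t -> 0 <= rho t &
      mass rho T @[T --> +oo] --> 1%E].

(* The infimum is attained for densities, since the integral is continuous
   in s. *)
Definition quantile (rho : R -> R) (r : R) : R :=
  inf [set s | 0 <= s /\ mass rho s = r%:E].

Definition tail (rho : R -> R) (r : R) : R -> R :=
  fun t => rho (t + quantile rho r).

Definition uniform_density (h : R) : R -> R := fun t => h * \1_`[0, h^-1] t.

(* Unlike [total_variation], this only uses points a < t1 < ... < tn < b, so
   that the value at the end point b does not matter. *)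
Definition total_variation_co (a b : R) (f : R -> R) : \bar R :=
  ereal_sup [set (variation a b f s)%:E
            | s in [set s : seq R | path <%R a s /\ all (fun t => t < b) s]].

(* The case split accounts for ln 0 = -oo, since [ln 0] is 0 here. *)
Definition log_variation (a b : R) (rho : R -> R) : \bar R :=
  if `[< forall t, a <= t < b -> 0 < rho t >]
  then total_variation_co a b (fun t => ln (rho t)) else +oo%E.

Definition regular_family (rho : R -> R -> R) : Prop :=
  forall r, 0 < r < 1 ->
    limf_esup (fun h => log_variation 0 (quantile (rho h) r) (rho h)) 0^'+
      \is a fin_num.

End Densities.

Section Payoffs.
Context {R : realType} {Omega : Type}.
Local Notation mu := (@lebesgue_measure R).
Implicit Types (g : Omega -> R) (rho : R -> R).

Definition payoff g rho (z : process R Omega) : R :=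
  \int[mu]_(t in `[0, +oo[) (rho t * g (z (time t))).

Definition truncated_payoff g (K : set (process R Omega))
    (BB : set (set (process R Omega))) (r : R) rho (z : process R Omega) : R :=
  \int[mu]_(t in `[0, quantile rho r]) (rho t * g (z (time t))) +
  upper_value K BB (payoff g (tail rho r)) (z (time (quantile rho r))).

End Payoffs.

(* Main.v *)
Require Import Defs.
From mathcomp Require Import all_boot all_order all_algebra.
From mathcomp Require Import all_classical all_reals all_analysis.
From mathcomp Require Import measurable_realfun ring lra.
Set Implicit Arguments.
Unset Strict Implicit.
Unset Printing Implicit Defensive.
Import Order.TTheory GRing.Theory Num.Theory.
Import numFieldTopology.Exports numFieldNormedType.Exports.
Local Open Scope classical_set_scope.
Local Open Scope ring_scope.

(** Write T for the time r / h at which the mass r of the uniform density of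
    rate h has been played, and consider the block game with payoff
      h * (integral of g over [0, T]) + (1 - r) * Vstar (z T).
    Since the tail of a uniform density after its r-quantile is 1 - r times a
    uniform density of smaller horizon, this is, up to a uniformly small error,
    the truncated game of the uniform density.  Dynamic programming (play well
    up to T, then well from the state reached) shows that, up to such an error,
    the uniform game has an upper value at most that of the block game and a
    lower value at least that of the block game.  Since both values of the
    uniform game are close to Vstar and the two values of the truncated game are
    close to each other, all of them are close to Vstar ([upper_block_le]).  So, for every small r and for all small
    h, playing one block at constant rate and then collecting Vstar is worth
    Vstar.

    A regular density is handled by cutting the half-line at the times t_k at
    which the mass (1 - r)^k remains to be played.  On [t_k, t_{k+1}] the density
    is within a factor exp v_k of its mean, where v_k is the variation of its
    logarithm over that block, so the block game with
    h = r / (t_{k+1} - t_k) approximates it with an error r (exp v_k - 1), in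
    addition to the error e of the block game itself
    ([upper_value_block_step]).  Summing backwards over N blocks
    ([upper_value_regular_density]), the first errors add up to at most
    r C exp C, as the v_k add up to at most the bound C on the log-variation:
    it is small if r is.  The others add up to N e, with N fixed, and what
    comes after t_N is worth at most a constant times (1 - r)^N.  Finally h is
    small on each block because the density is at most exp C times the mass
    that it gives to [0, 1], which vanishes in the limit
    ([density_le_initial_mass]).

    All this is done for upper values only: the lower value of a payoff is
    minus the upper value, for the other player, of the opposite payoff
    ([lower_valueE]), and changing g and Vstar into their opposites preserves
    the whole argument.  The two bounds meet because the lower value never
    exceeds the upper one. *)

(** * Upper values and dynamic programming *)

Section Values.
Context {R : realType} {Omega : Type} (K : set (process R Omega)).
Implicit Types (F : set (set (process R Omega))) (c : process R Omega -> R).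
Implicit Types (z : process R Omega) (w : Omega).

Definition bounded_payoff c := exists M, forall z, K z -> `|c z| <= M.

(** Exchanging the players amounts to changing the sign of the payoff; with
    this, every estimate below is proved for upper values only. *)
Lemma lower_valueE F c w :
  lower_value K F c w = - upper_value K F (fun z => - c z) w.
Proof.
rewrite /lower_value /upper_value /inf opprK image_comp; congr sup.
apply: eq_imagel => A _ /=; congr (- sup _).
by rewrite image_comp.
Qed.

Context F (F0 : F !=set0) (Fp : axiom_p K F).

Let bounded_sups c w : bounded_payoff c ->
  has_lbound [set sup [set c z | z in B `&` issued K w] | B in F].
Proof.
move=> [M cM]; exists (- M) => _ [B FB <-].
have [_ /(_ w)[z [Bz wz]]] := Fp FB.
apply: (@le_trans _ _ (c z)).
  by have := cM _ wz.1; rewrite ler_norml => /andP[].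
apply: ub_le_sup; last by exists z.
by exists M => _ [y [_ [Ky _]] <-]; exact: le_trans (ler_norm _) (cM _ Ky).
Qed.

Lemma upper_value_le c B w x : bounded_payoff c -> F B ->
  (forall z, B z -> issued K w z -> c z <= x) -> upper_value K F c w <= x.
Proof.
move=> bc FB cx; apply: (@le_trans _ _ (sup [set c z | z in B `&` issued K w])).
  by apply: ge_inf; [exact: bounded_sups|exists B].
have [_ /(_ w)[z [Bz wz]]] := Fp FB.
apply: ge_sup; first by exists (c z), z.
by move=> _ [y [By wy] <-]; exact: cx.
Qed.

Lemma upper_value_attained c w e : bounded_payoff c -> 0 < e ->
  exists2 B, F B & forall z, B z -> issued K w z ->
    c z <= upper_value K F c w + e.
Proof.
move=> bc e0; have hinf : has_inf [set sup [set c z | z in B `&` issued K w] | B in F].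
  by split; [case: F0 => B FB; eexists; exists B|exact: bounded_sups].
have [_ [B FB <-] Be] := inf_adherent e0 hinf.
exists B => // z Bz wz; apply: le_trans (ltW Be).
apply: ub_le_sup; last by exists z.
case: bc => M cM.
by exists M => _ [y [_ [Ky _]] <-]; exact: le_trans (ler_norm _) (cM _ Ky).
Qed.

Lemma upper_value_le_affine c1 c2 w a b : bounded_payoff c1 ->
  bounded_payoff c2 -> 0 <= a ->
  (forall z, issued K w z -> c1 z <= a * c2 z + b) ->
  upper_value K F c1 w <= a * upper_value K F c2 w + b.
Proof.
move=> b1 b2 a0 c12; apply/ler_addgt0Pr => e e0.
have a1 : 0 < a + 1 by rewrite ltr_wpDl.
have [B FB Be] := upper_value_attained w b2 (divr_gt0 e0 a1).
apply: (upper_value_le b1 FB) => z Bz wz; apply: le_trans (c12 _ wz) _.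
rewrite addrAC lerD2r (le_trans (ler_wpM2l a0 (Be _ Bz wz)))//.
rewrite mulrDr lerD2l mulrCA ger_pMr// ler_pdivrMr// mul1r.
by rewrite lerDl.
Qed.

Lemma upper_value_bound c w M : (forall z, K z -> `|c z| <= M) ->
  `|upper_value K F c w| <= M.
Proof.
move=> cM; have bc : bounded_payoff c by exists M.
rewrite ler_norml; apply/andP; split; last first.
  case: F0 => B FB; apply: (upper_value_le bc FB) => z _ [Kz _].
  exact: le_trans (ler_norm _) (cM _ Kz).
apply/ler_addgt0Pr => e e0.
have [B FB Be] := upper_value_attained w bc e0.
have [_ /(_ w)[z [Bz wz]]] := Fp FB.
apply: le_trans (Be _ Bz wz).
by have := cM _ wz.1; rewrite ler_norml => /andP[].
Qed.

(** Dynamic programming: follow a nearly optimal strategy of the game with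
    payoff c1 + u until time S, then switch to a strategy that is nearly optimal
    for c2 from whatever state has been reached.  The axiom on selections glues
    the latter, one for each state, into a single strategy, and the axiom on
    concatenations makes the switch admissible. *)
Lemma upper_value_concat c c1 c2 (u : Omega -> R) S w :
  axiom_concat F -> axiom_omega K F ->
  0 < S -> bounded_payoff c -> bounded_payoff c2 ->
  bounded_payoff (fun z => c1 z + u (z (time S))) ->
  (forall z1 z2, K z1 -> K z2 -> K (concat (time S) z1 z2) ->
     c (concat (time S) z1 z2) <= c1 z1 + c2 z2) ->
  (forall w', upper_value K F c2 w' <= u w') ->
  upper_value K F c w <= upper_value K F (fun z => c1 z + u (z (time S))) w.
Proof.
move=> Fcat Fom S0 bc b2 b1 cle c2u; apply/ler_addgt0Pr => e e0.
have e20 : 0 < e / 2 by rewrite divr_gt0.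
have [B1 FB1 B1e] := upper_value_attained w b1 e20.
have {Fom}[|B2 FB2 xiB2] := Fom (fun w' => sval (cid2 (upper_value_attained w' b2 e20))).
  by move=> w'; case: cid2.
have tS0 : 0 < (time S)%:num by rewrite /= normr_gt0 gt_eqF.
have FB := Fcat _ _ _ tS0 FB1 FB2.
apply: (upper_value_le bc FB) => _ [z1 [z2 [Bz1 Bz2 z12 ->]]] [Kz zw].
have Kz1 := (Fp FB1).1 _ Bz1; have Kz2 := (Fp FB2).1 _ Bz2.
apply: le_trans (cle _ _ Kz1 Kz2 Kz) _.
have z1w : z1 (time 0) = w.
  by rewrite -zw /concat ifT//= normr0 normr_gt0 gt_eqF.
have {}xiB2 := xiB2 (z1 (time S)).
have : (B2 `&` issued K (z1 (time S))) z2 by split.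
rewrite -xiB2; case: cid2 => /= B FB' Be [/Be/[apply] {}Be].
rewrite [e]splitr addrA (le_trans _ (lerD (B1e _ Bz1 (conj Kz1 z1w)) (lexx _)))//.
by rewrite -addrA lerD2l (le_trans Be)// lerD2r.
Qed.

End Values.

(** A process common to nearly optimal strategies of both players costs at least
    about the lower value and at most about the upper one. *)
Lemma lower_le_upper_value {R : realType} {Omega : Type} (K : set (process R Omega))
    AA BB c w : AA !=set0 -> BB !=set0 -> axiom_p K AA -> axiom_p K BB ->
  axiom_s K AA BB -> bounded_payoff K c ->
  lower_value K AA c w <= upper_value K BB c w.
Proof.
move=> A0 B0 Ap Bp ABs bc; rewrite lower_valueE.
have bNc : bounded_payoff K (fun z => - c z).
  by case: bc => M cM; exists M => z Kz; rewrite normrN cM.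
apply/ler_addgt0Pr => e e0; have e20 : 0 < e / 2 by rewrite divr_gt0.
have [A AA_A Ae] := upper_value_attained A0 Ap w bNc e20.
have [B BB_B Be] := upper_value_attained B0 Bp w bc e20.
have [z [[Az Bz] wz]] := ABs A B w AA_A BB_B.
move: (Ae _ Az wz) (Be _ Bz wz); lra.
Qed.

(** * Translation of integrals over the half-line *)

Section Translation.
Context {R : realType}.
Local Notation mu := (@lebesgue_measure R).
Implicit Types (a : R) (D : set R).

Let measurable_translation a :
  measurable_fun [set: measurableTypeR R] (fun t : measurableTypeR R => t + a : measurableTypeR R).
Proof. exact: measurable_realfun.measurable_funD. Qed.

Let translated a : {measure set (measurableTypeR R) -> \bar R} :=
  measure_function_pushforward__canonical__measure_function_Measure
    mu (measurable_translation a).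

(** Both measures agree on the half-open intervals, hence everywhere. *)
Lemma lebesgue_measure_translation a (A : set R) : measurable A ->
  mu A = pushforward mu (fun t : R => t + a) A.
Proof.
move=> mA; apply: (@lebesgue_measure_unique R (translated a)) => // _ [[x y] _ <-] /=.
rewrite /pushforward (_ : _ @^-1` _ = `]x - a, y - a]%classic); last first.
  by apply/seteqP; split => t /=; rewrite !in_itv/= ltrBlDr lerBrDr.
rewrite !lebesgue_measure_itv/= !lte_fin ltrD2r; case: ifP => // _.
by rewrite -!EFinB; congr EFin; lra.
Qed.

Let ge0_integral_translation a D (f : R -> \bar R) : measurable D ->
  measurable_fun D f -> (forall t, 0 <= f t)%E ->
  (\int[mu]_(t in D) f t =
   \int[mu]_(t in (fun t : R => (t + a)%R) @^-1` D) f (t + a)%R)%E.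
Proof.
move=> mD mf f0.
rewrite (@eq_measure_integral _ _ _ _ (translated a)); last first.
  by move=> A mA _; exact: lebesgue_measure_translation.
exact: (ge0_integral_pushforward (measurable_translation a) mu mD mf).
Qed.

Lemma integral_translation a D (f : R -> \bar R) : measurable D ->
  measurable_fun D f ->
  (\int[mu]_(t in D) f t =
   \int[mu]_(t in (fun t : R => (t + a)%R) @^-1` D) f (t + a)%R)%E.
Proof.
move=> mD mf; rewrite integralE [RHS]integralE.
pose phi (t : R) : R := t + a.
have posE : (fun t : R => f (t + a)%R)^\+%E = (f^\+ \o phi)%E by rewrite -funepos_comp.
have negE : (fun t : R => f (t + a)%R)^\-%E = (f^\- \o phi)%E by rewrite -funeneg_comp.
rewrite posE negE; congr (_ - _)%E.
- exact: ge0_integral_translation mD (measurable_funepos mf) (funepos_ge0 _).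
- exact: ge0_integral_translation mD (measurable_funeneg mf) (funeneg_ge0 _).
Qed.

Lemma Rintegral_halfline_translation a (f : R -> R) :
  measurable_fun (`[a, +oo[ : set R) f ->
  \int[mu]_(t in `[a, +oo[) f t = \int[mu]_(t in `[0, +oo[) f (t + a).
Proof.
move=> mf; rewrite /Rintegral (@integral_translation a)//; last exact/measurable_EFinP.
congr (fine (integral _ _ _)).
by apply/seteqP; split => t /=; rewrite !in_itv/= !andbT lerDr.
Qed.

End Translation.

(** * Payoffs of concatenated processes *)

Section PayoffCalculus.
Context {R : realType} {Omega : Type}.
Local Notation mu := (@lebesgue_measure R).
Implicit Types (rho : R -> R) (z : process R Omega) (g : Omega -> R).

Definition halfline_integrable rho :=
  mu.-integrable (`[0, +oo[ : set R) (EFin \o rho).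

(** The density seen from time a; unlike [tail], the time is given directly and
    not as a quantile, so that delays compose. *)
Definition delay (a : R) rho : R -> R := fun t => rho (t + a).

Lemma delayD a b rho : delay b (delay a rho) = delay (a + b) rho.
Proof. by apply/funext => t; rewrite /delay -addrA [b + a]addrC. Qed.

Lemma halfline_integrable_delay a rho : 0 <= a ->
  halfline_integrable rho -> halfline_integrable (delay a rho).
Proof.
move=> a0 /integrableP[/measurable_EFinP mrho irho].
have sub : (`[a, +oo[ : set R) `<=` `[0, +oo[.
  by move=> t; rewrite /= !in_itv/= !andbT; exact: le_trans.
apply/integrableP; split.
  apply/measurable_EFinP; rewrite -[delay a rho]/(rho \o (fun t : R => t + a)).
  refine (@measurable_comp _ _ _ _ _ _ (`[0, +oo[%classic : set R) rho _ _ _ _ _ _) => //.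
    by move=> _ [t + <-]; rewrite /= !in_itv/= !andbT => t0; rewrite addr_ge0.
  exact: measurable_funD.
apply: le_lt_trans irho.
have mabs : measurable_fun (`[0, +oo[ : set R) (fun t => `|(rho t)%:E|)%E.
  by apply: measurableT_comp => //; exact/measurable_EFinP.
have -> : (\int[mu]_(t in `[0%R, +oo[) `|(EFin \o delay a rho) t| =
          \int[mu]_(t in `[a, +oo[) `|(rho t)%:E|)%E.
  rewrite [RHS](@integral_translation _ a)//; last first.
    exact: (measurable_funS (measurable_itv _) sub mabs).
  congr integral.
  by apply/seteqP; split => t /=; rewrite !in_itv/= !andbT lerDr.
exact: ge0_subset_integral.
Qed.

Lemma Rintegral_halfline_split rho a : 0 <= a -> halfline_integrable rho ->
  \int[mu]_(t in `[0, +oo[) rho t =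
  \int[mu]_(t in `[0, a]) rho t + \int[mu]_(t in `[0, +oo[) delay a rho t.
Proof.
move=> a0 irho.
have sub : (`[a, +oo[ : set R) `<=` `[0, +oo[.
  by move=> t; rewrite /= !in_itv/= !andbT; exact: le_trans.
have ia : mu.-integrable (`[a, +oo[ : set R) (EFin \o rho).
  exact: integrableS irho.
have /integrableP[/measurable_EFinP mrho _] := ia.
rewrite -(Rintegral_halfline_translation mrho).
have isub : mu.-integrable (`]a, +oo[ : set R) (EFin \o rho).
  apply: integrableS irho => // t.
  by rewrite /= !in_itv/= !andbT => /ltW; apply: le_trans.
rewrite -(Rintegral_itv_obnd_cbnd isub) -(Rintegral_itvB irho) ?bnd_simp//.
by rewrite addrC subrK.
Qed.

Context (g : Omega -> R) (g1 : forall w, `|g w| <= 1).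

Definition observable z :=
  measurable_fun (`[0, +oo[ : set R) (fun t : R => g (z (time t))).

Lemma halfline_integrable_payoff rho z : observable z -> halfline_integrable rho ->
  halfline_integrable (fun t => rho t * g (z (time t))).
Proof.
move=> mz irho; have /integrableP[/measurable_EFinP mrho _] := irho.
apply: (le_integrable _ _ _ irho) => //.
  by apply/measurable_EFinP; exact: measurable_funM.
by move=> t _ /=; rewrite lee_fin normrM ler_piMr.
Qed.

Lemma payoff_norm rho z : observable z -> halfline_integrable rho ->
  (forall t : R, 0 <= t -> 0 <= rho t) ->
  `|payoff g rho z| <= \int[mu]_(t in `[0, +oo[) rho t.
Proof.
move=> mz irho rho0; have ipay := halfline_integrable_payoff mz irho.
apply: le_trans (le_normr_Rintegral _ ipay) _ => //.
apply: le_Rintegral => //; first exact: integrable_norm ipay.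
move=> t; rewrite /= in_itv/= andbT => t0.
by rewrite normrM -[leRHS]ger0_norm ?rho0// ler_piMr.
Qed.

(** The concatenation follows z1 on [0, S[ only, but the instant S is
    negligible. *)
Lemma payoff_concat rho (S : R) z1 z2 : 0 < S -> halfline_integrable rho ->
  observable (concat (time S) z1 z2) ->
  payoff g rho (concat (time S) z1 z2) =
  \int[mu]_(t in `[0, S]) (rho t * g (z1 (time t))) + payoff g (delay S rho) z2.
Proof.
move=> S0 irho mz; have ipay := halfline_integrable_payoff mz irho.
have sub : (`[0, S[ : set R) `<=` `[0, +oo[.
  by move=> t; rewrite /= !in_itv/= andbT => /andP[].
have early t : t \in `[0, S[ -> concat (time S) z1 z2 (time t) = z1 (time t).
  by rewrite in_itv/= => /andP[t0 tS]; rewrite /concat ifT//= ger0_norm// gtr0_norm.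
rewrite /payoff (Rintegral_halfline_split (ltW S0) ipay); congr (_ + _).
  have ipS : mu.-integrable (`[0, S[ : set R)
      (EFin \o (fun t => rho t * g (concat (time S) z1 z2 (time t)))).
    exact: integrableS ipay.
  rewrite -!Rintegral_itv_bndo_bndc//.
  - by apply: eq_Rintegral => t; rewrite inE/= => tS; rewrite early.
  - apply: eq_integrable ipS => // t; rewrite inE/= => tS.
    by rewrite /= early.
apply: eq_Rintegral => t; rewrite inE/= in_itv/= andbT => t0; rewrite /delay.
rewrite /concat ifF; last first.
  by rewrite /= !ger0_norm ?addr_ge0// ?(ltW S0)// ltNge lerDr t0.
by rewrite /= !ger0_norm ?addr_ge0// ?(ltW S0)// addrK.
Qed.

Lemma integrable_process a z : 0 <= a -> observable z ->
  mu.-integrable (`[0, a] : set R) (EFin \o (fun t => g (z (time t)))).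
Proof.
move=> a0 mz.
have sub : (`[0, a] : set R) `<=` `[0, +oo[.
  by move=> t; rewrite /= !in_itv/= andbT => /andP[].
have mza : measurable_fun (`[0, a] : set R) (fun t : R => g (z (time t))).
  exact: (measurable_funS _ sub mz).
have i1 : mu.-integrable (`[0, a] : set R) (EFin \o cst (1 : R)).
  apply: measurable_bounded_integrable => //.
    by rewrite /= lebesgue_measure_itv/=; case: ifP => // _; rewrite -EFinB ltry.
  by exists 1; split => // M M1 t _ /=; rewrite normr1 ltW.
apply: le_integrable i1 => //; first exact/measurable_EFinP.
by move=> t _ /=; rewrite lee_fin normr1.
Qed.

Lemma payoffN rho z : observable z -> halfline_integrable rho ->
  payoff (fun w => - g w) rho z = - payoff g rho z.
Proof.
move=> mz irho; rewrite /payoff -mulN1r -RintegralZl//; last exact: halfline_integrable_payoff.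
by apply: eq_Rintegral => t _; rewrite mulrN mulN1r.
Qed.

End PayoffCalculus.

(** * One block of play at nearly constant rate *)

Section Block.
Context {R : realType} {Omega : Type}.
Local Notation mu := (@lebesgue_measure R).
Implicit Types (rho : R -> R) (z : process R Omega) (V : Omega -> R).
Implicit Types (h r d M X : R).

(** Play until the uniform density of rate h has spent the mass r, then receive
    the remaining mass 1 - r times V at the state reached. *)
Definition block_payoff (g V : Omega -> R) (h r : R) z : R :=
  h * \int[mu]_(t in `[0, r / h]) g (z (time t)) + (1 - r) * V (z (time (r / h))).

Lemma Rintegral_norm_le (S d : R) (f : R -> R) : 0 <= S ->
  mu.-integrable (`[0, S] : set R) (EFin \o f) ->
  (forall t : R, 0 <= t <= S -> `|f t| <= d) ->
  `|\int[mu]_(t in `[0, S]) f t| <= d * S.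
Proof.
move=> S0 fi fd; apply: le_trans (le_normr_Rintegral _ fi) _ => //.
have Sfin : mu (`[0, S]%classic : set R) = S%:E.
  by rewrite lebesgue_measure_itv/= lte_fin; case: ltgtP S0 => // [|<-]; rewrite ?oppr0 ?adde0.
rewrite [leRHS](_ : _ = \int[mu]_(t in `[0, S]) cst d t); last first.
  by rewrite Rintegral_cst//= Sfin.
apply: le_Rintegral => //; first exact: integrable_norm fi.
apply: measurable_bounded_integrable => //.
  by rewrite /= Sfin ltry.
exists `|d|; split => // M M1 t _ /=; exact: ltW.
Qed.

Context (K : set (process R Omega)) (F : set (set (process R Omega))).
Context (F0 : F !=set0) (Fp : axiom_p K F).
Context (Fcat : axiom_concat F) (Fom : axiom_omega K F).
Context (g : Omega -> R) (g1 : forall w, `|g w| <= 1).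
Context (gm : forall z, K z -> observable g z).
Context (V : Omega -> R) (B : R) (VB : forall w, `|V w| <= B).

Lemma bounded_payoff_density rho : halfline_integrable rho ->
  (forall t : R, 0 <= t -> 0 <= rho t) -> bounded_payoff K (payoff g rho).
Proof.
move=> irho rho0; eexists => z Kz.
exact (payoff_norm g1 (gm Kz) irho rho0).
Qed.

Lemma bounded_block_payoff h r : 0 < h -> 0 < r < 1 ->
  bounded_payoff K (block_payoff g V h r).
Proof.
move=> h0 /andP[r0 r1]; exists (r + B) => z Kz.
have S0 : 0 <= r / h by rewrite divr_ge0// ltW.
apply: le_trans (ler_normD _ _) _; apply: lerD.
  rewrite normrM gtr0_norm// -[leRHS](divfK (lt0r_neq0 h0)).
  rewrite mulrC ler_wpM2r ?(ltW h0)// -[leRHS]mul1r.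
  exact: (Rintegral_norm_le S0 (integrable_process g1 S0 (gm Kz))).
rewrite normrM; apply: le_trans (VB (z (time (r / h)))).
by rewrite ler_piMl// gtr0_norm; lra.
Qed.

(** If rho is within d of the constant rate M h on [0, r / h] and what comes
    afterwards is worth at most M (1 - r) V + X, then by dynamic programming the
    game is worth at most M times a block game, up to d times the length r / h
    of the block, plus X. *)
Lemma upper_value_le_block rho M h r d X w : 0 < h -> 0 < r < 1 -> 0 <= M ->
  halfline_integrable rho -> (forall t : R, 0 <= t -> 0 <= rho t) ->
  (forall t : R, 0 <= t <= r / h -> `|rho t - M * h| <= d) ->
  (forall w', upper_value K F (payoff g (delay (r / h) rho)) w' <=
              M * (1 - r) * V w' + X) ->
  upper_value K F (payoff g rho) w <=
  M * upper_value K F (block_payoff g V h r) w + (d * (r / h) + X).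
Proof.
move=> h0 r01 M0 irho rho0 rhoM tailV.
have S0 : 0 < r / h by case/andP: r01 => r0 r1; rewrite divr_gt0.
set S := r / h in S0 rhoM tailV *.
have ishift := halfline_integrable_delay (ltW S0) irho.
have shift0 t : 0 <= t -> 0 <= delay S rho t.
  by move=> t0; rewrite rho0// addr_ge0// ltW.
have sub : (`[0, S] : set R) `<=` `[0, +oo[.
  by move=> t; rewrite /= !in_itv/= andbT => /andP[].
pose c1 z := \int[mu]_(t in `[0, S]) (rho t * g (z (time t))).
pose u w' := M * (1 - r) * V w' + X.
have c1block z : K z ->
    `|c1 z + u (z (time S)) - X - M * block_payoff g V h r z| <= d * S.
  move=> Kz.
  have ir : mu.-integrable (`[0, S] : set R) (EFin \o (fun t => rho t * g (z (time t)))).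
    exact: integrableS (halfline_integrable_payoff g1 (gm Kz) irho).
  have ig := integrable_process g1 (ltW S0) (gm Kz).
  have iMg : mu.-integrable (`[0, S] : set R) (EFin \o (fun t => M * h * g (z (time t)))).
    have mS : measurable (`[0, S]%classic : set (measurableTypeR R)) by exact: measurable_itv.
    by have := integrableZl mS (M * h) ig.
  rewrite [X in `|X|](_ : _ = \int[mu]_(t in `[0, S])
      (rho t * g (z (time t)) - M * h * g (z (time t)))); last first.
    rewrite RintegralB// RintegralZl// /u /block_payoff /c1 -/S; ring.
  apply: Rintegral_norm_le (ltW S0) _ _.
    have mS : measurable (`[0, S]%classic : set (measurableTypeR R)) by exact: measurable_itv.
    by have := integrableB mS ir iMg.
  move=> t tS; rewrite -mulrBl normrM; apply: le_trans (rhoM _ tS).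
  by rewrite ler_piMr.
have bblock := bounded_block_payoff h0 r01.
have bc1u : bounded_payoff K (fun z => c1 z + u (z (time S))).
  case: bblock => N blockN; exists (d * S + M * N + `|X|) => z Kz.
  rewrite [X in `|X|](_ : _ = (c1 z + u (z (time S)) - X -
    M * block_payoff g V h r z) + M * block_payoff g V h r z + X); last by ring.
  apply: le_trans (ler_normD _ _) _; rewrite lerD2r.
  apply: le_trans (ler_normD _ _) _; rewrite lerD ?c1block//.
  by rewrite normrM ger0_norm// ler_wpM2l// blockN.
apply: (@le_trans _ _ (upper_value K F (fun z => c1 z + u (z (time S))) w)).
  apply: (@upper_value_concat _ _ K F F0 Fp _ c1 (payoff g (delay S rho))) => //.
  - exact: bounded_payoff_density.
  - exact: bounded_payoff_density.
  by move=> z1 z2 _ _ /gm mz; rewrite (payoff_concat g1).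
apply: upper_value_le_affine => // z [/c1block].
rewrite ler_norml => /andP[_ +] _; lra.
Qed.

End Block.

(** * Probability densities *)

Section DensityFacts.
Context {R : realType}.
Local Notation mu := (@lebesgue_measure R).
Context (rho : R -> R) (rho_density : is_density rho).

Definition played_mass (f : R -> R) (t : R) : R := \int[mu]_(s in `[0, t]) f s.
Local Notation F := (played_mass rho).

Lemma density_ge0 (t : R) : 0 <= t -> 0 <= rho t.
Proof. by case: rho_density => _ + _; apply. Qed.

Let mrho : measurable_fun (`[0, +oo[ : set R) (EFin \o rho).
Proof. by case: rho_density => ? _ _; exact/measurable_EFinP. Qed.

(** Letting T run through the integers in the defining limit. *)
Let total_mass : (\int[mu]_(t in `[0%R, +oo[) (rho t)%:E = 1)%E.
Proof.
have nd : nondecreasing_seq (fun n => `[0, n%:R]%classic : set R).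
  move=> m n mn; rewrite subsetEset => t /=; rewrite !in_itv/= => /andP[-> tm].
  by rewrite (le_trans tm)// ler_nat.
have cup : \bigcup_n (`[0, n%:R]%classic : set R) = `[0, +oo[%classic.
  apply/seteqP; split => t.
    by move=> [n _]; rewrite /= !in_itv/= andbT => /andP[].
  rewrite /= in_itv/= andbT => t0; exists (Num.Def.truncn t).+1 => //=.
  by rewrite in_itv/= t0/= ltW// truncnS_gt.
have sub n : (`[0, n%:R]%classic : set R) `<=` `[0, +oo[.
  by move=> t; rewrite /= !in_itv/= andbT => /andP[].
have lim1 : (\int[mu]_(t in `[0%R, n%:R]) (rho t)%:E @[n --> \oo] -->
             \int[mu]_(t in `[0%R, +oo[) (rho t)%:E)%E.
  rewrite -cup; apply: (@ge0_nondecreasing_set_cvg_integral _ (measurableTypeR R) R _ _ mu) => //.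
  - by move=> n; exact: (measurable_funS _ (sub n) mrho).
  - by move=> n t; rewrite /= in_itv/= => /andP[t0 _]; rewrite lee_fin density_ge0.
have lim2 : (\int[mu]_(t in `[0%R, n%:R]) (rho t)%:E @[n --> \oo] --> 1)%E.
  case: rho_density => _ _; apply: cvg_comp; exact: cvgr_idn.
exact: cvg_unique lim1 lim2.
Qed.

Lemma density_integrable : halfline_integrable rho.
Proof.
apply/integrableP; split => //.
have -> : (\int[mu]_(t in `[0%R, +oo[) `|(EFin \o rho) t| =
           \int[mu]_(t in `[0%R, +oo[) (rho t)%:E)%E.
  apply: eq_integral => t; rewrite inE/= in_itv/= andbT => t0.
  by rewrite ger0_norm// density_ge0.
by rewrite total_mass ltry.
Qed.

Let integrable_itv (a b : R) : 0 <= a ->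
  mu.-integrable (`[a, b] : set R) (EFin \o rho).
Proof.
move=> a0; apply: integrableS density_integrable => // t.
by rewrite /= !in_itv/= andbT => /andP[+ _]; exact: le_trans.
Qed.

Lemma massE t : mass rho t = (F t)%:E.
Proof.
rewrite /mass /played_mass /Rintegral fineK//.
exact: integrable_fin_num (integrable_itv t (lexx 0)).
Qed.

Lemma Rintegral_delay t : 0 <= t ->
  \int[mu]_(s in `[0, +oo[) delay t rho s = 1 - F t.
Proof.
move=> t0; rewrite -[1](_ : \int[mu]_(s in `[0, +oo[) rho s = _); last first.
  by rewrite /Rintegral total_mass.
by rewrite (Rintegral_halfline_split t0 density_integrable) /played_mass addrAC subrr add0r.
Qed.

Section Increment.
Context (a b : R) (a0 : 0 <= a) (ab : a <= b).

Let integrable_increment : mu.-integrable (`]a, b] : set R) (EFin \o rho).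
Proof.
apply: integrableS (integrable_itv b a0) => // t.
by rewrite /= !in_itv/= => /andP[/ltW -> ->].
Qed.

Let integrable_cst k : mu.-integrable (`]a, b] : set R) (EFin \o cst k).
Proof.
apply: measurable_bounded_integrable => //.
  by rewrite /= lebesgue_measure_itv/=; case: ifP => // _; rewrite -EFinB ltry.
by exists `|k|; split => // M M1 t _ /=; exact: ltW.
Qed.

Let Rintegral_length k : \int[mu]_(t in `]a, b]) cst k t = k * (b - a).
Proof.
rewrite Rintegral_cst//= lebesgue_measure_itv/= lte_fin.
by case: ltgtP ab => //= ->; rewrite subrr.
Qed.

Lemma played_mass_incrementE : F b - F a = \int[mu]_(t in `]a, b]) rho t.
Proof. by rewrite /played_mass (Rintegral_itvB (integrable_itv b (lexx 0))). Qed.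

Lemma le_played_mass_increment k : (forall t, a <= t <= b -> k <= rho t) ->
  k * (b - a) <= F b - F a.
Proof.
move=> krho; rewrite played_mass_incrementE -Rintegral_length.
have := integrable_increment; have := integrable_cst k => icst irho.
apply: le_Rintegral => //.
by move=> t; rewrite /= in_itv/= => /andP[/ltW ta tb]; rewrite krho// ta.
Qed.

Lemma played_mass_increment_le k : (forall t, a <= t <= b -> rho t <= k) ->
  F b - F a <= k * (b - a).
Proof.
move=> rhok; rewrite played_mass_incrementE -Rintegral_length.
have := integrable_increment; have := integrable_cst k => icst irho.
apply: le_Rintegral => //.
by move=> t; rewrite /= in_itv/= => /andP[/ltW ta tb]; rewrite rhok// ta.
Qed.

End Increment.

Lemma played_mass0 : F 0 = 0.
Proof. by rewrite /played_mass set_itv1 Rintegral_set1. Qed.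

Lemma played_mass_le (a b : R) : 0 <= a -> a <= b -> F a <= F b.
Proof.
move=> a0 ab; rewrite -subr_ge0 -(mul0r (b - a)).
apply: le_played_mass_increment => // t /andP[at_ _].
exact/density_ge0/(le_trans a0).
Qed.

Lemma played_mass_lt (a b : R) : 0 <= b -> F a < F b -> a < b.
Proof. by move=> b0 Fab; rewrite ltNge; apply/negP => /(played_mass_le b0); rewrite leNgt Fab. Qed.

Lemma played_mass_surj (y : R) : 0 <= y < 1 -> exists2 t, 0 <= t & F t = y.
Proof.
move=> /andP[y0 y1].
have [T T0 yT] : exists2 T, 0 <= T & y < F T.
  case: rho_density => _ _ lim.
  have {}lim : F T @[T --> +oo] --> (1 : R).
    apply: (@fine_cvg _ _ _ _ (fun T => (F T)%:E)).
    by rewrite -(_ : mass rho = (fun T => (F T)%:E)) //; exact/funext/massE.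
  near (pinfty_nbhs R) => T; exists T; first by near: T; exact: nbhs_pinfty_ge.
  by near: T; exact: cvgr_gt lim _ y1.
have := parameterized_integral_continuous T0 (integrable_itv T (lexx 0)).
move=> /(IVT T0 (v := y)) [].
  by rewrite /parameterized_integral -/(F 0) -/(F T) played_mass0 minElt maxElt (le_lt_trans y0 yT) y0 ltW.
move=> t; rewrite in_itv/= => /andP[t0 _] Ft; by exists t.
Unshelve. all: by end_near. Qed.

(** The infimum defining the quantile could a priori be approached by times
    close to t; a time t' at which the mass is halfway between that of t and p
    separates them. *)
Lemma played_mass_lt_quantile (t p : R) : 0 <= t -> F t < p < 1 ->
  t < quantile rho p.
Proof.
move=> t0 /andP[Ftp p1].
have Ft0 : 0 <= F t by rewrite -played_mass0 played_mass_le.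
have [t' t'0 Ft'] : exists2 t', 0 <= t' & F t' = (F t + p) / 2.
  apply: played_mass_surj; lra.
have [s s0 Fs] : exists2 s, 0 <= s & F s = p by apply: played_mass_surj; lra.
apply: (@lt_le_trans _ _ t'); first by apply: played_mass_lt => //; lra.
apply: lb_le_inf; first by exists s; rewrite /= massE Fs.
move=> u [u0]; rewrite massE => -[Fu].
by apply/ltW/played_mass_lt => //; lra.
Qed.

(** A function whose values are comparable up to a factor E is comparable to its
    mean up to the same factor. *)
Lemma density_near_mean (a b E : R) : 0 <= a -> a < b -> 1 <= E ->
  (forall s s', a <= s <= b -> a <= s' <= b -> rho s <= E * rho s') ->
  forall s, a <= s <= b ->
    `|rho s - (F b - F a) / (b - a)| <= (E - 1) * ((F b - F a) / (b - a)).
Proof.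
move=> a0 ab E1 osc s sab; have ba0 : 0 < b - a by rewrite subr_gt0.
have E0 : 0 < E := lt_le_trans ltr01 E1.
have E10 : 0 <= E - 1 by rewrite subr_ge0.
set m := _ / _; have mE : m * (b - a) = F b - F a by rewrite divfK ?gt_eqF.
have m0 : 0 <= m by rewrite divr_ge0 ?subr_ge0 ?played_mass_le// ltW.
have sm : E^-1 * rho s <= m.
  rewrite -(ler_pM2r ba0) mE; apply: (le_played_mass_increment a0 (ltW ab)) => s' s'ab.
  by rewrite ler_pdivrMl// osc.
have ms : m <= E * rho s.
  rewrite -(ler_pM2r ba0) mE; apply: (played_mass_increment_le a0 (ltW ab)) => s' s'ab.
  exact: osc.
move: sm; rewrite ler_pdivrMl// => sm; rewrite ler_norml; apply/andP; split.
  have [mle|/ltW slem] := leP m (rho s); first by have := mulr_ge0 E10 m0; lra.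
  by have := ler_wpM2l E10 slem; lra.
lra.
Qed.

(** The value at s is at most E times the mean over [0, 1], which is the mass of
    this interval.  This is how the vanishing of the mass of bounded intervals
    forces the density itself to be small. *)
Lemma density_le_initial_mass (b E s : R) : 1 <= b -> 0 < E ->
  (forall s', 0 <= s' <= b -> rho s <= E * rho s') -> rho s <= E * F 1.
Proof.
move=> b1 E0 sE; rewrite -ler_pdivrMl// -[leRHS]subr0 -[in leRHS]played_mass0.
rewrite -[leLHS]mulr1 -[X in _ * X](subr0 1).
apply: le_played_mass_increment => // s' /andP[s'0 s'1].
by rewrite ler_pdivrMl// sE// s'0 (le_trans s'1).
Qed.

End DensityFacts.

(** * Oscillation of a density over a block *)

Section LogVariation.
Context {R : realType}.
Implicit Types (f rho : R -> R) (a b q : R).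

Lemma path_le_last a (s : seq R) : path <%R a s ->
  all (fun t => t <= last a s) (a :: s).
Proof.
elim: s a => [|x s ih] a /=; first by rewrite lexx.
move=> /andP[ax /ih /= /andP[xl ->]].
by rewrite xl (le_trans (ltW ax) xl).
Qed.

(** The subdivisions of [a, b] stay strictly below q, so they are among those
    of [a, q[. *)
Lemma total_variation_le_co a b q f : b < q ->
  (total_variation a b f <= total_variation_co a q f)%E.
Proof.
move=> bq; apply: ge_ereal_sup => _ [_ [s [pas /eqP sb] <-] <-].
apply: ereal_sup_ubound; exists s.
  split => //; have /= /andP[_] := path_le_last pas.
  by apply: sub_all => t tl; rewrite (le_lt_trans tl)// sb.
congr EFin; rewrite /variation; apply: eq_big_nat => i /andP[_ si].
congr (`| f _ - f _ |); apply: set_nth_default => //=; exact: ltnW.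
Qed.

(** W t is the total variation of ln rho over [0, t].  Its increments bound the
    oscillation of ln rho on each block, and they telescope: this is what bounds
    the sum of the oscillations over all blocks by C. *)
Lemma log_variation_control rho q C : (log_variation 0 q rho <= C%:E)%E ->
  exists W : R -> R,
  [/\ forall t, 0 <= t < q -> 0 <= W t <= C,
      forall a b, 0 <= a -> a <= b -> b < q -> W a <= W b &
      forall a b s t, 0 <= a -> b < q -> a <= s <= b -> a <= t <= b ->
        rho s <= expR (W b - W a) * rho t].
Proof.
rewrite /log_variation; case: asboolP => [rho0|_]; last by rewrite leye_eq.
set f := fun t => ln (rho t) => fC.
have TVC b : 0 <= b < q -> (0 <= total_variation 0 b f <= C%:E)%E.
  move=> /andP[b0 bq]; rewrite total_variation_ge0//=.
  exact: le_trans (total_variation_le_co _ _ bq) fC.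
have TVfin b : 0 <= b < q -> total_variation 0 b f \is a fin_num.
  move=> /TVC /andP[b0 bC]; rewrite ge0_fin_numE//.
  by rewrite (le_lt_trans bC)// ltry.
have osc a b : 0 <= a -> a <= b -> b < q -> `|f b - f a| <=
    fine (total_variation 0 b f) - fine (total_variation 0 a f).
  move=> a0 ab bq; have b0 := le_trans a0 ab.
  rewrite -lee_fin EFinB !fineK ?TVfin ?a0 ?b0 ?bq ?(le_lt_trans ab)//.
  rewrite (total_variationD f a0 ab) addeAC subee ?add0e; first exact: total_variation_ge.
  by rewrite TVfin// a0 (le_lt_trans ab).
pose W t := fine (total_variation 0 t f).
have Wmono a b : 0 <= a -> a <= b -> b < q -> W a <= W b.
  by move=> a0 ab bq; rewrite -subr_ge0; apply: le_trans (osc a b a0 ab bq).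
exists W; split => //.
  by move=> t tq; rewrite -!lee_fin fineK ?TVfin// TVC.
move=> a b s t a0 bq /andP[as_ sb] /andP[at_ tb].
have s0 := le_trans a0 as_; have t0 := le_trans a0 at_.
have rs : 0 < rho s by rewrite rho0// s0 (le_lt_trans sb).
have rt : 0 < rho t by rewrite rho0// t0 (le_lt_trans tb).
rewrite -(lnK rs) -(lnK rt) -expRD ler_expR -lerBlDr -/(f s) -/(f t) -/(W a) -/(W b).
have [st|ts] := leP s t.
  apply: le_trans (ler_norm _) _; rewrite distrC.
  apply: le_trans (osc _ _ s0 st (le_lt_trans tb bq)) _.
  by apply: lerB; apply: Wmono => //; rewrite (le_lt_trans sb).
apply: le_trans (ler_norm _) _.
apply: le_trans (osc _ _ t0 (ltW ts) (le_lt_trans sb bq)) _.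
by apply: lerB; apply: Wmono => //; rewrite (le_lt_trans tb).
Qed.

End LogVariation.

(** * Playing a regular density block by block *)

Section RegularDensity.
Context {R : realType} {Omega : Type}.
Context (K : set (process R Omega)) (F : set (set (process R Omega))).
Context (F0 : F !=set0) (Fp : axiom_p K F).
Context (Fcat : axiom_concat F) (Fom : axiom_omega K F).
Context (g : Omega -> R) (g1 : forall w, `|g w| <= 1).
Context (gm : forall z, K z -> observable g z).
Context (V : Omega -> R) (B : R) (VB : forall w, `|V w| <= B).

(** From 1 - v <= expR (- v), after multiplication by expR v. *)
Lemma expR_subr1_le (C v : R) : v <= C -> 0 <= v -> expR v - 1 <= expR C * v.
Proof.
move=> vC v0; apply: (@le_trans _ _ (expR v * v)).
  have : expR v * expR (- v) = 1 by rewrite expRN divff ?expR_eq0.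
  have := ler_wpM2l (expR_ge0 v) (expR_ge1Dx (- v)).
  by move=> + ev; rewrite ev; lra.
by rewrite ler_wpM2r// ler_expR.
Qed.

(** One step of the backward induction: a bound for the game that starts at b
    yields one for the game that starts at a, where [a, b] carries the fraction
    r of the mass M that remains at a.  The bound c on the density ensures that
    the block game involved has a rate below h0. *)
Lemma upper_value_block_step (rho : R -> R) (a b M r E c h0 e X : R) :
  is_density rho -> 0 <= a -> a < b -> 0 < M <= 1 -> 0 < r < 1 -> 0 <= e -> 1 <= E ->
  played_mass rho b - played_mass rho a = r * M ->
  (forall s s', a <= s <= b -> a <= s' <= b -> rho s <= E * rho s') ->
  (forall s, a <= s <= b -> rho s <= c) -> c < h0 * M ->
  (forall h w, 0 < h < h0 -> upper_value K F (block_payoff g V h r) w <= V w + e) ->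
  (forall w, upper_value K F (payoff g (delay b rho)) w <= M * (1 - r) * V w + X) ->
  forall w, upper_value K F (payoff g (delay a rho)) w <=
    M * V w + (r * (E - 1) + e + X).
Proof.
move=> drho a0 ab /andP[M0 M1] r01 e0 E1 inc osc rhoc ch0 block tail w.
have /andP[r0 r1] := r01; have ba0 : 0 < b - a by rewrite subr_gt0.
(* the rate at which a block of mass r lasts b - a *)
have [h hE] : exists h, h = r / (b - a) by eexists.
have h_gt0 : 0 < h by rewrite hE divr_gt0.
have rh : r / h = b - a by rewrite hE invf_div mulrCA divff ?mulr1// gt_eqF.
have meanE : (played_mass rho b - played_mass rho a) / (b - a) = M * h.
  by rewrite inc hE mulrAC mulrC.
have near_mean := density_near_mean drho a0 ab E1 osc; rewrite meanE in near_mean.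
have hh0 : h < h0.
  rewrite -(ltr_pM2r M0); apply: le_lt_trans ch0; rewrite mulrC -meanE ler_pdivrMr//.
  exact (played_mass_increment_le drho a0 (ltW ab) rhoc).
have dev s : 0 <= s <= r / h -> `|delay a rho s - M * h| <= (E - 1) * (M * h).
  rewrite rh => /andP[s0 sba]; apply: near_mean.
  by rewrite lerDr s0 -lerBrDr.
have tail' w' : upper_value K F (payoff g (delay (r / h) (delay a rho))) w' <=
    M * (1 - r) * V w' + X.
  by rewrite rh delayD addrC subrK.
have := upper_value_le_block F0 Fp Fcat Fom g1 gm VB w h_gt0 r01 (ltW M0)
  (halfline_integrable_delay a0 (density_integrable drho)) _ dev tail'.
move=> /(_ _)/le_trans; apply.
  by move=> s s0; rewrite (density_ge0 drho)// addr_ge0.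
have cost : (E - 1) * (M * h) * (r / h) <= r * (E - 1).
  rewrite -mulrA -[M * h * _]mulrA mulrC [h * _]mulrC divfK ?gt_eqF// mulrC.
  by rewrite mulrC ler_wpM2r ?subr_ge0// ler_piMl// ltW.
have blk : M * upper_value K F (block_payoff g V h r) w <= M * V w + e.
  apply: le_trans (ler_wpM2l (ltW M0) (block h w _)) _; first by rewrite h_gt0.
  by rewrite mulrDr lerD2l ler_piMl.
lra.
Qed.

(** Backward induction over the N blocks.  The three errors are the value of
    what remains after the last block, the N errors e of the block games, and
    the errors r (expR v - 1) <= r expR C v due to the oscillations v of the
    logarithm of the density. *)
Lemma upper_value_regular_density (rho : R -> R) (delta C r e h0 : R) (N : nat) w :
  is_density rho -> 0 < delta < 1 ->
  (log_variation 0 (quantile rho (1 - delta)) rho <= C%:E)%E ->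
  0 < r < 1 -> delta < (1 - r) ^+ N -> 0 <= e ->
  played_mass rho 1 < r -> expR C * played_mass rho 1 < h0 * delta ->
  (forall h w, 0 < h < h0 -> upper_value K F (block_payoff g V h r) w <= V w + e) ->
  upper_value K F (payoff g rho) w <=
    V w + (1 + B) * (1 - r) ^+ N + N%:R * e + r * expR C * C.
Proof.
move=> drho /andP[d0 d1] varC r01 dN e0 small1 smallC block.
have /andP[r0 r1] := r01.
have M01 k : 0 < (1 - r) ^+ k <= 1.
  by rewrite exprn_gt0 ?exprn_ile1//; lra.
(* At time t k the mass (1 - r) ^+ k remains to be played; the last clause makes
   the first block start at time 0 exactly. *)
have /boolp.choice[t tP] : forall k, exists x : R,
    [/\ 0 <= x, played_mass rho x = 1 - (1 - r) ^+ k & (k == 0)%N -> x = 0].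
  case=> [|k]; first by exists 0; rewrite expr0 subrr played_mass0.
  have [|x x0 xE] := played_mass_surj drho (y := 1 - (1 - r) ^+ k.+1).
    by have := M01 k.+1; lra.
  by exists x.
have t0 k : 0 <= t k by case: (tP k).
have Ft k : played_mass rho (t k) = 1 - (1 - r) ^+ k by case: (tP k).
have t00 : t 0%N = 0 by case: (tP 0%N) => _ _; apply.
have tlt k l : (k < l)%N -> t k < t l.
  move=> kl; apply: (played_mass_lt drho (t0 l)); rewrite !Ft ltrD2l ltrN2.
  by rewrite ltr_iXn2l ?subr_gt0 ?gtrBl.
have tle k l : (k <= l)%N -> t k <= t l.
  by rewrite leq_eqVlt => /predU1P[->//|/tlt/ltW].
have tNq : t N < quantile rho (1 - delta).
  by apply: (played_mass_lt_quantile drho (t0 N)); rewrite Ft; lra.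
have tq k : (k <= N)%N -> t k < quantile rho (1 - delta).
  by move=> kN; rewrite (le_lt_trans (tle _ _ kN)).
have [W [W0C Wmono Wosc]] := log_variation_control varC.
have WC k : (k <= N)%N -> 0 <= W (t k) <= C by move=> kN; rewrite W0C// t0 tq.
(* X k bounds the error made from time t k on. *)
pose X k := (1 + B) * (1 - r) ^+ N + (N - k)%:R * e +
  r * expR C * (W (t N) - W (t k)).
suff main j : (j <= N)%N -> forall w', upper_value K F
    (payoff g (delay (t (N - j)%N) rho)) w' <=
    (1 - r) ^+ (N - j) * V w' + X (N - j)%N.
  have := main N (leqnn N) w; rewrite subnn t00 /X subn0 t00 expr0 mul1r.
  rewrite (_ : delay 0 rho = rho); last by apply/funext => s; rewrite /delay addr0.
  move=> /le_trans; apply; rewrite !addrA lerD2l ler_wpM2l//.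
    by rewrite mulr_ge0 ?expR_ge0// ltW.
  by have := WC N (leqnn N); have := WC 0%N isT; rewrite t00; lra.
elim: j => [_ w'|j ih jN w'].
  rewrite subn0 /X subnn mul0r addr0 subrr mulr0 addr0.
  have tail_norm z : K z -> `|payoff g (delay (t N) rho) z| <= (1 - r) ^+ N.
    move=> Kz; rewrite -[leRHS](subKr 1) -Ft -(Rintegral_delay drho)//.
    apply: (payoff_norm g1 (gm Kz)).
      exact: halfline_integrable_delay (density_integrable drho).
    by move=> s s0; rewrite (density_ge0 drho)// addr_ge0.
  have := upper_value_bound F0 Fp w' tail_norm.
  have := VB w'; rewrite !ler_norml => /andP[VB1 _] /andP[_].
  have /andP[/ltW + _] := M01 N; move=> /mulr_ge0 /(_ (_ : 0 <= V w' + B)).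
  by rewrite -lerBlDr sub0r => /(_ VB1); lra.
have [k kE] : exists k, (N - j.+1 = k)%N by eexists.
have kE1 : (N - j = k.+1)%N by rewrite -kE subnSK.
have kN : (k < N)%N by rewrite -kE ltn_subrL (leq_ltn_trans _ jN).
rewrite kE; move: ih; rewrite kE1 => /(_ (ltnW jN)) ih.
pose v := W (t k.+1) - W (t k).
have v0 : 0 <= v by rewrite subr_ge0 Wmono ?tle ?tq.
have vC : v <= C.
  by have := WC k.+1 kN; have := WC k (ltnW kN); rewrite /v => /andP[+ _] /andP[_]; lra.
have small s : t k <= s <= t k.+1 -> rho s <= expR C * played_mass rho 1.
  move=> /andP[ks sk]; have s0 := le_trans (t0 k) ks; have sN := le_trans sk (tle _ _ kN).
  have t1N : 1 <= t N.
    apply: le_trans (tle 1%N N _); last exact: leq_ltn_trans kN.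
    by apply/ltW/(played_mass_lt drho (t0 1%N)); rewrite Ft expr1 subKr.
  apply: (density_le_initial_mass drho t1N (expR_gt0 C)) => s' /[dup] s'N /andP[s'0 _].
  apply: le_trans (Wosc 0 (t N) s s' _ tNq _ s'N) _ => //; first by rewrite s0.
  rewrite ler_wpM2r ?(density_ge0 drho)// ler_expR.
  have := WC N (leqnn N); have := WC 0%N isT.
  by rewrite t00 => /andP[+ _] /andP[_]; lra.
have MN : delta <= (1 - r) ^+ k.
  by apply: le_trans (ltW dN) (ler_wiXn2l _ _ (ltnW kN)); lra.
have h00 : 0 < h0.
  rewrite -(pmulr_lgt0 _ d0); apply: le_lt_trans smallC.
  have := played_mass_le drho (lexx 0) ler01.
  by rewrite played_mass0 => /(mulr_ge0 (expR_ge0 C)).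
have step := @upper_value_block_step rho (t k) (t k.+1) ((1 - r) ^+ k) r (expR v)
  (expR C * played_mass rho 1) h0 e (X k.+1) drho (t0 k) (tlt _ _ (ltnSn k))
  (M01 k) r01 e0 _ _ (fun s s' => Wosc _ _ s s' (t0 k) (tq _ kN)) small _ block _.
apply: le_trans (step _ _ _ _ w') _.
- by apply: le_trans (expR_ge1Dx v); rewrite lerDl.
- by rewrite !Ft exprS; ring.
- by apply: lt_le_trans smallC _; rewrite ler_pM2l.
- by move=> w''; rewrite -exprSr; exact: ih.
rewrite lerD2l.
have := ler_wpM2l (ltW r0) (expR_subr1_le vC v0).
by rewrite /X /v -(subnSK kN) -natr1; lra.
Qed.

End RegularDensity.

(** * Uniform densities *)

Section UniformDensity.
Context {R : realType}.
Local Notation mu := (@lebesgue_measure R).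

Lemma uniform_density_in (h t : R) : 0 <= t <= h^-1 -> uniform_density h t = h.
Proof. by move=> th; rewrite /uniform_density indicE mem_set/= ?in_itv/= ?mulr1. Qed.

Lemma mass_uniform_density (h s : R) : 0 < h -> 0 <= s ->
  mass (uniform_density h) s = (h * Num.min s h^-1)%:E.
Proof.
move=> h0 s0; rewrite /mass /uniform_density.
under eq_integral do rewrite EFinM.
rewrite ge0_integralZl//; last 2 first.
- by apply/measurable_EFinP; exact: measurable_indic.
- by rewrite lee_fin ltW.
rewrite integral_indic// (_ : _ `&` _ = `[0, Num.min s h^-1]%classic); last first.
  apply/seteqP; split => t /=; rewrite !in_itv/= le_min.
    by move=> [/andP[-> ->] /andP[_ ->]].
  by move=> /and3P[-> -> ->].
have m0 : 0 <= Num.min s h^-1 by rewrite le_min s0 invr_ge0 ltW.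
rewrite EFinM; congr (_ * _)%E.
suff : mu (`[0, Num.min s h^-1]%classic : set R) = (Num.min s h^-1)%:E by [].
rewrite lebesgue_measure_itv/= lte_fin; case: ltgtP m0 => //= [_|<-] _.
  by rewrite oppr0 adde0.
by [].
Qed.

Lemma uniform_density_is_density (h : R) : 0 < h -> is_density (uniform_density h).
Proof.
move=> h0; split.
- apply: measurable_funM => //; exact: measurable_indic.
- by move=> t _; rewrite /uniform_density mulr_ge0// ltW.
- apply: cvg_near_cst; near=> T.
  have T1 : h^-1 <= T by near: T; apply: nbhs_pinfty_ge; exact: num_real.
  have T0 : 0 <= T by rewrite (le_trans _ T1)// invr_ge0 ltW.
  by rewrite mass_uniform_density// min_r// divff// gt_eqF.
Unshelve. all: by end_near. Qed.

Lemma quantile_uniform_density (h r : R) : 0 < h -> 0 < r < 1 ->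
  quantile (uniform_density h) r = r / h.
Proof.
move=> h0 /andP[r0 r1]; rewrite /quantile (_ : mkset _ = [set r / h]) ?inf1//.
apply/seteqP; split => s /=.
  move=> [s0]; rewrite mass_uniform_density// => -[].
  rewrite minEle; case: ifP => _; first by move=> <-; rewrite mulrAC divff ?mul1r// gt_eqF.
  by rewrite divff ?gt_eqF// => re; rewrite -re ltxx in r1.
move=> ->; split; first by rewrite divr_ge0// ltW.
rewrite mass_uniform_density ?divr_ge0 ?(ltW r0) ?(ltW h0)// min_l.
  by rewrite mulrC divfK ?gt_eqF.
by rewrite ler_piMl ?invr_ge0 ?ltW.
Qed.

(** The tail of a uniform density after its r-quantile is 1 - r times the
    uniform density on the remaining interval, of length (1 - r) / h. *)
Lemma tail_uniform_density (h r t : R) : 0 < h -> 0 < r < 1 -> 0 <= t ->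
  uniform_density h (t + r / h) = (1 - r) * uniform_density (h / (1 - r)) t.
Proof.
move=> h0 /andP[r0 r1] t0; have r1' : 0 < 1 - r by rewrite subr_gt0.
rewrite /uniform_density !indicE mulrA [(1 - r) * _]mulrC divfK ?gt_eqF//.
congr (_ * _%:R); rewrite (_ : (_ \in _) = (t \in `[0, (h / (1 - r))^-1]%classic))//.
apply/idP/idP; rewrite !inE/= !in_itv/= t0 addr_ge0 ?divr_ge0 ?(ltW r0) ?(ltW h0)//=;
  by rewrite invf_div mulrBl mul1r lerBrDr.
Qed.

End UniformDensity.

Section UniformPayoff.
Context {R : realType} {Omega : Type}.
Local Notation mu := (@lebesgue_measure R).
Context (K : set (process R Omega)) (F : set (set (process R Omega))).
Context (F0 : F !=set0) (Fp : axiom_p K F).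
Context (g : Omega -> R) (g1 : forall w, `|g w| <= 1).
Context (gm : forall z, K z -> observable g z).

Lemma uniform_integrable (h : R) : 0 < h -> halfline_integrable (uniform_density h).
Proof. by move=> h0; apply: density_integrable; exact: uniform_density_is_density. Qed.

Lemma payoff_uniform_tail (h r : R) z : 0 < h -> 0 < r < 1 -> K z ->
  payoff g (delay (r / h) (uniform_density h)) z =
  (1 - r) * payoff g (uniform_density (h / (1 - r))) z.
Proof.
move=> h0 r01 Kz; have h'0 : 0 < h / (1 - r) by rewrite divr_gt0// subr_gt0; case/andP: r01.
rewrite /payoff -RintegralZl//; last exact: (halfline_integrable_payoff g1 (gm Kz) (uniform_integrable h'0)).
apply: eq_Rintegral => t; rewrite inE/= in_itv/= andbT => t0.
by rewrite /delay tail_uniform_density// mulrA.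
Qed.

Lemma bounded_payoff_uniform (h : R) : 0 < h -> bounded_payoff K (payoff g (uniform_density h)).
Proof.
move=> h0; apply: (bounded_payoff_density g1 gm); first exact: uniform_integrable.
by case: (uniform_density_is_density h0).
Qed.

Lemma upper_value_uniform_tail (h r : R) w : 0 < h -> 0 < r < 1 ->
  upper_value K F (payoff g (delay (r / h) (uniform_density h))) w =
  (1 - r) * upper_value K F (payoff g (uniform_density (h / (1 - r)))) w.
Proof.
move=> h0 r01; have r1 : 0 < 1 - r by rewrite subr_gt0; case/andP: r01.
have h'0 : 0 < h / (1 - r) by rewrite divr_gt0.
have b' := bounded_payoff_uniform h'0.
have b : bounded_payoff K (payoff g (delay (r / h) (uniform_density h))).
  case: b' => M bM; exists ((1 - r) * M) => z Kz.
  by rewrite payoff_uniform_tail// normrM gtr0_norm// ler_wpM2l ?bM// ltW.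
apply/eqP; rewrite eq_le; apply/andP; split.
  rewrite -[leRHS]addr0; apply: upper_value_le_affine => //; first exact: ltW.
  by move=> z [Kz _]; rewrite payoff_uniform_tail// addr0.
rewrite -ler_pdivlMl// -[leRHS]addr0; apply: upper_value_le_affine => //.
  by rewrite invr_ge0 ltW.
by move=> z [Kz _]; rewrite payoff_uniform_tail// addr0 mulrA mulVf ?mul1r// gt_eqF.
Qed.

Context (V : Omega -> R) (B : R) (VB : forall w, `|V w| <= B).

(** The truncated payoff only differs from the block payoff by having the upper
    value of a uniform game in place of its limit V. *)
Lemma truncated_payoff_uniform (h r e : R) z : 0 < h -> 0 < r < 1 -> K z ->
  (forall w, `|upper_value K F (payoff g (uniform_density (h / (1 - r)))) w - V w| <= e) ->
  `|truncated_payoff g K F r (uniform_density h) z - block_payoff g V h r z| <= e.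
Proof.
move=> h0 r01 Kz VE; have /andP[r0 r1] := r01.
have S0 : 0 <= r / h by rewrite divr_ge0// ltW.
rewrite /truncated_payoff /tail quantile_uniform_density// -/(delay _ _).
rewrite upper_value_uniform_tail// /block_payoff.
rewrite (_ : \int[mu]_(t in `[0, r / h]) (uniform_density h t * g (z (time t))) =
   h * \int[mu]_(t in `[0, r / h]) g (z (time t))); last first.
  rewrite -RintegralZl//; last exact: (integrable_process g1 S0 (gm Kz)).
  apply: eq_Rintegral => t; rewrite inE/= in_itv/= => /andP[t0 tr].
  by rewrite uniform_density_in// t0 (le_trans tr)// ler_piMl ?invr_ge0 ?ltW.
rewrite opprD addrACA subrr add0r -mulrBr normrM; apply: le_trans (VE (z (time (r / h)))).
by rewrite ler_piMl// gtr0_norm ?subr_gt0// gerBl ltW.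
Qed.

(** A uniform density is exactly constant on the block, so that dynamic
    programming only costs the distance of the tail value to V. *)
Lemma upper_value_uniform_le_block (h r e : R) w :
  axiom_concat F -> axiom_omega K F -> 0 < h -> 0 < r < 1 -> 0 <= e ->
  (forall w', upper_value K F (payoff g (uniform_density (h / (1 - r)))) w' <= V w' + e) ->
  upper_value K F (payoff g (uniform_density h)) w <=
  upper_value K F (block_payoff g V h r) w + e.
Proof.
move=> Fcat Fom h0 r01 e0 VE; have /andP[r0 r1] := r01.
have r1' : 0 < 1 - r by rewrite subr_gt0.
have := @upper_value_le_block _ _ K F F0 Fp Fcat Fom g g1 gm V B VB (uniform_density h) 1 h r 0 ((1 - r) * e) w h0 r01 ler01 (uniform_integrable h0).
case: (uniform_density_is_density h0) => _ u0 _ => /(_ u0) up.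
apply: le_trans (up _ _) _.
- move=> t /andP[t0 tr]; rewrite mul1r uniform_density_in ?subrr ?normr0//.
  by rewrite t0 (le_trans tr)// ler_piMl ?invr_ge0 ?ltW.
- by move=> w'; rewrite upper_value_uniform_tail// mul1r -mulrDr ler_pM2l.
- by rewrite mul1r mul0r add0r lerD2l ler_piMl// gerBl ltW.
Qed.

End UniformPayoff.

(** * From estimates to limits *)

Section Limits.
Context {R : realType}.

Lemma near0P (P : R -> Prop) :
  (\forall h \near 0^'+, P h) <-> exists2 d : R, 0 < d & forall h, 0 < h < d -> P h.
Proof.
split.
  move=> [d /= d0 dP]; exists d => // h /andP[h0 hd].
  by apply: dP => //=; rewrite sub0r normrN gtr0_norm.
move=> [d d0 dP]; exists d => //= h /=; rewrite sub0r normrN => hd h0.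
by apply: dP; rewrite h0 -[X in X < _]gtr0_norm.
Qed.

Lemma near0_div (P : R -> Prop) (a : R) : 0 < a ->
  (\forall h \near (0 : R)^'+, P h) -> \forall h \near (0 : R)^'+, P ((h : R) / a).
Proof.
move=> a0 /near0P[d d0 dP]; apply/near0P; exists (d * a); first exact: mulr_gt0.
by move=> h /andP[h0 hd]; apply: dP; rewrite divr_gt0//= ltr_pdivrMr.
Qed.

Lemma limf_esup_near (f : R -> \bar R) : limf_esup f 0^'+ \is a fin_num ->
  exists2 C : R, 0 < C & \forall h \near 0^'+, (f h <= C%:E)%E.
Proof.
move=> ffin; have : (limf_esup f 0^'+ < (fine (limf_esup f 0^'+) + 1)%:E)%E.
  by rewrite EFinD fineK// lteDl// lte_fin.
rewrite {1}limf_esupE => /ereal_inf_lt[_ [A A0 <-] Alt].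
exists (Num.max 1 (fine (limf_esup f 0^'+) + 1)); first by rewrite lt_max ltr01.
apply: filterS A0 => h Ah; apply: (@le_trans _ _ (fine (limf_esup f 0^'+) + 1)%:E).
  by apply: le_trans (ltW Alt); apply: ereal_sup_ubound; exists h.
by rewrite lee_fin le_max lexx orbT.
Qed.

(** N is the last exponent for which x ^+ N is still above delta. *)
Lemma exp_bracket (x delta : R) : 0 < x < 1 -> 0 < delta < 1 ->
  exists N, delta < x ^+ N /\ x ^+ N.+1 <= delta.
Proof.
move=> /andP[x0 x1] /andP[d0 d1].
have : exists n, x ^+ n <= delta.
  have /cvgrPdist_lt /(_ _ d0) [n _ /(_ n (leqnn n))] : x ^+ n @[n --> \oo] --> (0 : R).
    by apply: cvg_expr; rewrite gtr0_norm.
  by rewrite sub0r normrN => xn; exists n; apply: le_trans (ltW xn); exact: ler_norm.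
move=> /ex_minnP[[|n] xn nmin]; first by rewrite expr0 leNgt d1 in xn.
exists n; split => //; rewrite ltNge; apply/negP => /nmin.
by rewrite ltnn.
Qed.

Lemma mass_near0 (sigma : R -> R -> R) (T eta : R) :
  (forall m, 0 < m -> is_density (sigma m)) ->
  mass (sigma m) T @[m --> 0^'+] --> 0%E -> 0 < eta ->
  \forall m \near 0^'+, played_mass (sigma m) T < eta.
Proof.
move=> ds s0 eta0.
have /fine_cvg : mass (sigma m) T @[m --> 0^'+] --> (0 : R)%:E by [].
move=> /cvgrPdist_lt /(_ _ eta0); apply: filterS2; last exact: nbhs_right_gt.
move=> m /ds dm; rewrite /= massE// sub0r normrN /=.
exact: le_lt_trans (ler_norm _).
Qed.

End Limits.

Section OneSidedLimit.
Context {R : realType} {Omega : Type}.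
Context (K : set (process R Omega)) (F : set (set (process R Omega))).
Context (F0 : F !=set0) (Fp : axiom_p K F).
Context (Fcat : axiom_concat F) (Fom : axiom_omega K F).
Context (g : Omega -> R) (g1 : forall w, `|g w| <= 1).
Context (gm : forall z, K z -> observable g z).
Context (V : Omega -> R) (B : R) (VB : forall w, `|V w| <= B).

(** The parameters are chosen in this order: delta, the mass left unplayed; the
    bound C on the log-variation up to the quantile of 1 - delta; the relative
    size r of the blocks, small against 1 / (C expR C); their number N; the
    precision e of the block games, small against 1 / N; and finally m, for which the mass of [0, 1] must be
    small against all of them. *)
Lemma upper_value_regular_family (sigma : R -> R -> R) (eps : R) :
  (forall m, 0 < m -> is_density (sigma m)) -> regular_family sigma ->
  mass (sigma m) 1 @[m --> 0^'+] --> 0%E ->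
  (\forall r \near 0^'+, forall e : R, 0 < e -> \forall h \near 0^'+, forall w,
     upper_value K F (block_payoff g V h r) w <= V w + e) ->
  0 < eps ->
  \forall m \near 0^'+, forall w, upper_value K F (payoff g (sigma m)) w <= V w + eps.
Proof.
move=> dsigma regsigma vanish block eps0.
(* A state is needed to know that the bound B is nonnegative. *)
have [w0|noOmega] := pselect (exists w : Omega, True); last first.
  by near=> m => w; exfalso; apply: noOmega; exists w.
have B0 : 0 <= B by case: w0 => w _; apply: le_trans (VB w).
have B1 : 0 < 1 + B by rewrite ltr_pwDl.
have [delta [d0 dhalf dB]] : exists delta : R,
    [/\ 0 < delta, delta < 2^-1 & (1 + B) * (delta + delta) <= eps / 4].
  exists (Num.min (4^-1) (eps / (8 * (1 + B)))); split.
  - by rewrite lt_min invr_gt0 ltr0n divr_gt0// mulr_gt0.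
  - by rewrite gt_min; apply/orP; left; lra.
  - have : Num.min (4^-1) (eps / (8 * (1 + B))) <= eps / (8 * (1 + B)).
      by rewrite ge_min lexx orbT.
    move=> /(ler_wpM2l (ltW B1)).
    rewrite [(1 + B) * (eps / _)](_ : _ = eps / 8); last by field; rewrite gt_eqF.
    lra.
have d1 : 0 < delta < 1 by lra.
have [C C0 varC] := limf_esup_near (regsigma (1 - delta) ltac:(lra)).
have eC : 0 < expR C := expR_gt0 C.
have [r [r0 rhalf rC blockr]] : exists r, [/\ 0 < r, r < 2^-1, r * expR C * C <= eps / 4 &
    forall e : R, 0 < e -> \forall h \near 0^'+, forall w,
     upper_value K F (block_payoff g V h r) w <= V w + e].
  have [rho rho0 rhoP] := (near0P _).1 block.
  have eCC : 0 < expR C * C by rewrite mulr_gt0.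
  pose r := Num.min (rho / 2) (Num.min 4^-1 (eps / 4 / (expR C * C))).
  have r0 : 0 < r by rewrite !lt_min !divr_gt0// invr_gt0 ltr0n.
  exists r; split => //.
  - by rewrite !gt_min; apply/orP; right; apply/orP; left; lra.
  - by rewrite -mulrA -ler_pdivlMr// !ge_min lexx !orbT.
  - by apply: rhoP; rewrite r0 gt_min; apply/orP; left; lra.
have [N [dN Nd]] := @exp_bracket _ (1 - r) delta ltac:(lra) d1.
have Nsmall : (1 - r) ^+ N <= delta + delta.
  have : 2^-1 * (1 - r) ^+ N <= (1 - r) * (1 - r) ^+ N.
    by rewrite ler_wpM2r//; [rewrite exprn_ge0|]; lra.
  by move: Nd; rewrite exprS; lra.
pose e := eps / 4 / N.+1%:R.
have e0 : 0 < e by rewrite !divr_gt0.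
have Ne : N%:R * e <= eps / 4.
  rewrite /e mulrCA ger_pMr ?divr_gt0// ler_pdivrMr// mul1r ler_nat//.
have [h0 h00 blockh] := (near0P _).1 (blockr e e0).
pose eta := Num.min r (h0 * delta / expR C).
have eta0 : 0 < eta by rewrite lt_min r0 !(divr_gt0, mulr_gt0).
near=> m => w.
have m0 : 0 < m by near: m; exact: nbhs_right_gt.
have small : played_mass (sigma m) 1 < eta by near: m; exact: mass_near0.
have varm : (log_variation 0 (quantile (sigma m) (1 - delta)) (sigma m) <= C%:E)%E.
  by near: m; exact: varC.
have /andP[smallr smallC] : (played_mass (sigma m) 1 < r) && (played_mass (sigma m) 1 < h0 * delta / expR C).
  by rewrite -lt_min.
have smallC' : expR C * played_mass (sigma m) 1 < h0 * delta.
  by rewrite mulrC -ltr_pdivlMr.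
have r01 : 0 < r < 1 by lra.
apply: le_trans (upper_value_regular_density F0 Fp Fcat Fom g1 gm VB w (dsigma _ m0) d1
  varm r01 dN (ltW e0) smallr smallC' _) _.
  by move=> h w' hh0; exact: blockh.
have := ler_wpM2l (ltW B1) Nsmall.
lra.
Unshelve. all: by end_near. Qed.

End OneSidedLimit.

(** * The block game of the two players *)

Section TwoSided.
Context {R : realType} {Omega : Type} (K : set (process R Omega)).
Context (AA BB : set (set (process R Omega))).
Context (AA0 : AA !=set0) (BB0 : BB !=set0).
Context (AAp : axiom_p K AA) (AAconcat : axiom_concat AA) (AAomega : axiom_omega K AA).
Context (BBp : axiom_p K BB) (BBconcat : axiom_concat BB) (BBomega : axiom_omega K BB).
Context (g : Omega -> R) (g1 : forall w, `|g w| <= 1).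
Context (gm : forall z, K z -> observable g z).

Let Ng1 w : `|- g w| <= 1. Proof. by rewrite normrN. Qed.
Let Ngm z : K z -> observable (fun w => - g w) z.
Proof. by move=> /gm; exact: measurableT_comp. Qed.

Lemma eq_upper_value F (c1 c2 : process R Omega -> R) w :
  (forall z, K z -> c1 z = c2 z) -> upper_value K F c1 w = upper_value K F c2 w.
Proof.
move=> c12; congr inf; apply: eq_imagel => B _; congr sup.
by apply: eq_imagel => z [_ [Kz _]]; exact: c12.
Qed.

Lemma lower_value_payoff rho w : halfline_integrable rho ->
  lower_value K AA (payoff g rho) w =
  - upper_value K AA (payoff (fun w => - g w) rho) w.
Proof.
move=> irho; rewrite lower_valueE; congr (- _); apply: eq_upper_value => z Kz.
by rewrite (payoffN g1 (gm Kz)).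
Qed.

Lemma block_payoffN V h r z : 0 < h -> 0 < r -> K z ->
  block_payoff (fun w => - g w) (fun w => - V w) h r z = - block_payoff g V h r z.
Proof.
move=> h0 r0 Kz; rewrite /block_payoff mulrN opprD -[X in _ = X - _]mulrN; congr (_ * _ - _).
have S0 : 0 <= r / h by rewrite divr_ge0// ltW.
rewrite -[RHS]mulN1r -RintegralZl//; last exact: (integrable_process g1 S0 (gm Kz)).
by apply: eq_Rintegral => t _; rewrite mulN1r.
Qed.

Context (V : Omega -> R) (B : R) (VB : forall w, `|V w| <= B).
Context (upper_lim : uniform_limit0
  (fun h => upper_value K BB (payoff g (uniform_density h))) V).
Context (lower_lim : uniform_limit0
  (fun h => lower_value K AA (payoff g (uniform_density h))) V).

Let NVB w : `|- V w| <= B. Proof. by rewrite normrN. Qed.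

Lemma truncated_near_block (r e : R) : 0 < r < 1 -> 0 < e ->
  \forall h \near 0^'+, forall z, K z ->
   `|truncated_payoff g K BB r (uniform_density h) z - block_payoff g V h r z| <= e.
Proof.
move=> r01 e0; have r1 : 0 < 1 - r by rewrite subr_gt0; case/andP: r01.
apply: filterS2 (@near0_div R _ (1 - r) r1 (upper_lim e0)) (nbhs_right_gt 0).
move=> h near h0 z Kz; apply: (truncated_payoff_uniform BB0 BBp g1 gm) => // w.
exact/ltW/near.
Qed.

(** With the opposites of g and V, the block payoff becomes its opposite, so its
    upper value for the other player is minus the lower value of the block game:
    the sum below is the gap between the two values of the block game, which is
    close to that of the truncated game. *)
Lemma block_gap (r e : R) : 0 < r < 1 -> 0 < e ->
  asymptotic_saddle_point K AA BB
    (fun h => truncated_payoff g K BB r (uniform_density h)) ->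
  \forall h \near 0^'+, forall w,
   `|upper_value K AA (block_payoff (fun w => - g w) (fun w => - V w) h r) w +
     upper_value K BB (block_payoff g V h r) w| <= e.
Proof.
move=> r01 e0 saddle; have /andP[r0 r1] := r01.
have e30 : 0 < e / 3 by rewrite divr_gt0.
apply: filterS3 (truncated_near_block r01 e30) (saddle _ e30) (nbhs_right_gt 0).
move=> h close gap h0 w.
have bblk := bounded_block_payoff g1 gm VB h0 r01.
have bNblk := bounded_block_payoff Ng1 Ngm NVB h0 r01.
pose c := truncated_payoff g K BB r (uniform_density h).
have bc : bounded_payoff K c.
  case: bblk => M bM; exists (e / 3 + M) => z Kz.
  rewrite -[c z](subrK (block_payoff g V h r z)); apply: le_trans (ler_normD _ _) _.
  by rewrite lerD ?close ?bM.
have bNc : bounded_payoff K (fun z => - c z).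
  by case: bc => M bM; exists M => z Kz; rewrite normrN bM.
have close' z : K z -> - (e / 3) <= c z - block_payoff g V h r z <= e / 3.
  by move=> Kz; rewrite -ler_norml close.
have B1 : upper_value K BB c w <= 1 * upper_value K BB (block_payoff g V h r) w + e / 3.
  by apply: upper_value_le_affine => // z [/close' + _]; lra.
have B2 : upper_value K BB (block_payoff g V h r) w <= 1 * upper_value K BB c w + e / 3.
  by apply: upper_value_le_affine => // z [/close' + _]; lra.
have A1 : upper_value K AA (fun z => - c z) w <=
   1 * upper_value K AA (block_payoff (fun w => - g w) (fun w => - V w) h r) w + e / 3.
  by apply: upper_value_le_affine => // z [Kz _]; rewrite block_payoffN//; have := close' _ Kz; lra.
have A2 : upper_value K AA (block_payoff (fun w => - g w) (fun w => - V w) h r) w <=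
   1 * upper_value K AA (fun z => - c z) w + e / 3.
  by apply: upper_value_le_affine => // z [Kz _]; rewrite block_payoffN//; have := close' _ Kz; lra.
have := gap w; rewrite subr0 normr_id -/c lower_valueE => /ltW.
rewrite !ler_norml => /andP[G1 G2]; apply/andP; split; lra.
Qed.

Context (saddle : \forall r \near 0^'+, asymptotic_saddle_point K AA BB
       (fun h => truncated_payoff g K BB r (uniform_density h))).

Let near01 : \forall r \near (0 : R)^'+, 0 < r < 1.
Proof. by apply/near0P; exists 1. Qed.

Lemma uniform_upper_le_block (r e : R) : 0 < r < 1 -> 0 < e ->
  \forall h \near 0^'+, forall w,
   (V w - e <= upper_value K BB (block_payoff g V h r) w) /\
   (- V w - e <= upper_value K AA (block_payoff (fun w => - g w) (fun w => - V w) h r) w).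
Proof.
move=> r01 e0; have r1 : 0 < 1 - r by rewrite subr_gt0; case/andP: r01.
have e20 : 0 < e / 2 by rewrite divr_gt0.
pose close (h : R) := forall w,
  `|upper_value K BB (payoff g (uniform_density h)) w - V w| < e / 2 /\
  `|lower_value K AA (payoff g (uniform_density h)) w - V w| < e / 2.
have near_close : \forall h \near (0 : R)^'+, close h.
  by apply: filterS2 (upper_lim e20) (lower_lim e20) => h U L w; split; [exact: U|exact: L].
apply: filterS3 near_close (@near0_div R close (1 - r) r1 near_close) (nbhs_right_gt (0 : R)).
move=> h UL UL' h0 w.
have opp_near h' w' : 0 < h' ->
    `|lower_value K AA (payoff g (uniform_density h')) w' - V w'| < e / 2 ->
    `|upper_value K AA (payoff (fun w => - g w) (uniform_density h')) w' - - V w'| < e / 2.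
  move=> h'0; rewrite lower_value_payoff; last exact: uniform_integrable.
  by rewrite opprK -opprD normrN.
have h'0 : 0 < h / (1 - r) by rewrite divr_gt0.
have lb (x y v : R) : `|x - v| < e / 2 -> x <= y + e / 2 -> v - e <= y.
  by rewrite ltr_distl; lra.
have ub (x v : R) : `|x - v| < e / 2 -> x <= v + e / 2.
  by rewrite ltr_distl => /andP[_ /ltW].
split.
  apply: lb (UL w).1 _.
  apply: (upper_value_uniform_le_block BB0 BBp g1 gm VB) => //; first exact: ltW.
  by move=> w'; apply: ub; exact: (UL' w').1.
apply: lb (opp_near h w h0 (UL w).2) _.
apply: (upper_value_uniform_le_block AA0 AAp Ng1 Ngm NVB) => //; first exact: ltW.
by move=> w'; apply: ub; exact: opp_near (UL' w').2.
Qed.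

(** Squeezing: dynamic programming bounds the value of the block game for each
    player from one side, and the gap between the two values is small. *)
Lemma upper_block_le : \forall r \near 0^'+, forall e : R, 0 < e -> \forall h \near 0^'+, forall w,
  upper_value K BB (block_payoff g V h r) w <= V w + e /\
  upper_value K AA (block_payoff (fun w => - g w) (fun w => - V w) h r) w <= - V w + e.
Proof.
apply: filterS2 saddle near01 => r sr r01 e e0.
have e20 : 0 < e / 2 by rewrite divr_gt0.
apply: filterS2 (block_gap r01 e20 sr) (uniform_upper_le_block r01 e20).
move=> h gap low w; have := gap w; have [] := low w.
rewrite ler_norml => l1 l2 /andP[g_ g2]; split; lra.
Qed.

End TwoSided.

(** * The common limit *)

Theorem theorem2 (R : realType) (Omega : Type)
  (K : set (process R Omega)) (g : Omega -> R)
  (g01 : forall w, 0 <= g w <= 1)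
  (gmeas : forall z, K z ->
     measurable_fun (`[0, +oo[ : set R) (fun t : R => g (z (time t))))
  (AA BB : set (set (process R Omega)))
  (AA0 : AA !=set0) (BB0 : BB !=set0)
  (AAp : axiom_p K AA) (AAconcat : axiom_concat AA) (AAomega : axiom_omega K AA)
  (BBp : axiom_p K BB) (BBconcat : axiom_concat BB) (BBomega : axiom_omega K BB)
  (ABs : axiom_s K AA BB)
  (sigma : R -> R -> R)
  (sigma_density : forall m, 0 < m -> is_density (sigma m))
  (sigma_regular : regular_family sigma)
  (sigma_vanish : forall T : R, 0 < T -> mass (sigma m) T @[m --> 0^'+] --> 0%E)
  (trunc_saddle : \forall r \near 0^'+,
     asymptotic_saddle_point K AA BB
       (fun h => truncated_payoff g K BB r (uniform_density h)))
  (unif_saddle : asymptotic_saddle_point K AA BB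
     (fun h => payoff g (uniform_density h)))
  (Vstar : Omega -> R)
  (lower_lim : uniform_limit0
     (fun h => lower_value K AA (payoff g (uniform_density h))) Vstar)
  (upper_lim : uniform_limit0
     (fun h => upper_value K BB (payoff g (uniform_density h))) Vstar) :
  [/\ asymptotic_saddle_point K AA BB (fun m => payoff g (sigma m)),
      uniform_limit0 (fun m => lower_value K AA (payoff g (sigma m))) Vstar &
      uniform_limit0 (fun m => upper_value K BB (payoff g (sigma m))) Vstar].
Proof.
have g1 w : `|g w| <= 1 by have /andP[? ?] := g01 w; rewrite ger0_norm.
have Ng1 w : `|- g w| <= 1 by rewrite normrN.
have gm z : K z -> observable g z by exact: gmeas.
have Ngm z : K z -> observable (fun w => - g w) z.
  by move=> /gm; exact: measurableT_comp.
(* Uniform limits of bounded functions are bounded. *)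
have [B VB] : exists B, forall w, `|Vstar w| <= B.
  have [d d0 dP] := (near0P _).1 (upper_lim 1 ltr01).
  have d20 : 0 < d / 2 by rewrite divr_gt0.
  have [M bM] := bounded_payoff_uniform g1 gm d20.
  exists (M + 1) => w.
  have := upper_value_bound BB0 BBp w bM.
  have /dP /(_ w) : 0 < d / 2 < d by lra.
  rewrite distrC => /ltW V1 UM.
  rewrite -[Vstar w](subrK (upper_value K BB (payoff g (uniform_density (d / 2))) w)).
  by rewrite (le_trans (ler_normD _ _))// addrC lerD.
have NVB w : `|- Vstar w| <= B by rewrite normrN.
have block := upper_block_le AA0 BB0 AAp AAconcat AAomega BBp BBconcat BBomega g1 gm VB
  upper_lim lower_lim trunc_saddle.
have main e : 0 < e -> \forall m \near 0^'+, forall w,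
    [/\ Vstar w - e <= lower_value K AA (payoff g (sigma m)) w,
        lower_value K AA (payoff g (sigma m)) w <= upper_value K BB (payoff g (sigma m)) w &
        upper_value K BB (payoff g (sigma m)) w <= Vstar w + e].
  move=> e0; near=> m => w.
  have m0 : 0 < m by near: m; exact: nbhs_right_gt.
  have dm := sigma_density m m0; have im := density_integrable dm.
  split.
  - have : upper_value K AA (payoff (fun w => - g w) (sigma m)) w <= - Vstar w + e.
      move: w; near: m.
      apply: (upper_value_regular_family AA0 AAp AAconcat AAomega Ng1 Ngm NVB) => //.
      + exact: sigma_vanish.
      + by apply: filterS block => r blockr e' /blockr; apply: filterS => h bl w; have [] := bl w.
    by rewrite (lower_value_payoff _ g1 gm)//; lra.
  - apply: lower_le_upper_value => //; apply: bounded_payoff_density => //.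
    exact: density_ge0.
  - move: w; near: m; apply: (upper_value_regular_family BB0 BBp BBconcat BBomega g1 gm VB) => //.
    + exact: sigma_vanish.
    + by apply: filterS block => r blockr e' /blockr; apply: filterS => h bl w; have [] := bl w.
split.
- move=> e e0; have e20 : 0 < e / 3 by rewrite divr_gt0.
  apply: filterS (main _ e20) => m mP w; have [l1 l2 l3] := mP w.
  by rewrite subr0 normr_id ltr_norml; lra.
- move=> e e0; have e20 : 0 < e / 2 by rewrite divr_gt0.
  apply: filterS (main _ e20) => m mP w; have [l1 l2 l3] := mP w.
  by rewrite ltr_norml; lra.
- move=> e e0; have e20 : 0 < e / 2 by rewrite divr_gt0.
  apply: filterS (main _ e20) => m mP w; have [l1 l2 l3] := mP w.
  by rewrite ltr_norml; lra.
Unshelve. all: by end_near. Qed.
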